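(* Let $r$, $s$ and $m$ be arbitrary integers with $r\neq 0$. Then for each non-negative integer $n$, \[ \sum_{k = 0}^n (-1)^{k(s+1)} \binom {n}{k}^2 \Big (\frac{F_s}{F_r}\Big )^k F_{(r+s)k+m} = \sum_{k = 0}^n (-1)^{(s+1)(n-k)} \binom {n}{k} \binom {n+k}{k} \Big (\frac{F_{r+s}}{F_r}\Big )^{n-k} F_{s(n-k)+m}, \] \[ \sum_{k = 0}^n (-1)^{k(s+1)} \binom {n}{k}^2 \Big (\frac{F_s}{F_r}\Big )^k L_{(r+s)k+m} = \sum_{k = 0}^n (-1)^{(s+1)(n-k)} \binom {n}{k} \binom {n+k}{k} \Big (\frac{F_{r+s}}{F_r}\Big )^{n-k} L_{s(n-k)+m}. \]
   Context: $F_j$ and $L_j$ denote the Fibonacci and Lucas numbers: $F_0=0,F_1=1$, $L_0=2,L_1=1$, both satisfying $X_j=X_{j-1}+X_{j-2}$, extended to all integer indices via the recurrence (so $F_{-j}=(-1)^{j+1}F_j$, $L_{-j}=(-1)^jL_j$). *)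

(* Defs.v *)
From HB Require Import structures.
From mathcomp Require Import all_boot all_order all_algebra.
From mathcomp Require Import ring.

Set Implicit Arguments.
Unset Strict Implicit.
Unset Printing Implicit Defensive.

Import Order.TTheory GRing.Theory Num.Theory.
Local Open Scope ring_scope.

(* gib a b j is the term X_j of the sequence with X_0 = a, X_1 = b and
   X_j = X_(j-1) + X_(j-2) for all j : int; negative indices are reached by
   running the recurrence backwards, X_(j-2) = X_j - X_(j-1). *)
Fixpoint gib_up (a b : int) (n : nat) : int :=
  if n is n'.+1 then gib_up b (a + b) n' else a.

Fixpoint gib_down (a b : int) (n : nat) : int :=
  if n is n'.+1 then gib_down (b - a) a n' else a.

Definition gib (a b j : int) : int :=
  match j with
  | Posz n => gib_up a b n
  | Negz n => gib_down a b n.+1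
  end.

Definition fibz (j : int) : int := gib 0 1 j.

Definition lucz (j : int) : int := gib 2 1 j.

Lemma gib_upSS a b n : gib_up a b n.+2 = gib_up a b n.+1 + gib_up a b n.
Proof. by elim: n a b => [|n IHn] a b; [rewrite /= addrC | exact: (IHn b)]. Qed.

Lemma gib_downSS a b n :
  gib_down a b n = gib_down a b n.+1 + gib_down a b n.+2.
Proof. by elim: n a b => [|n IHn] a b; [rewrite /=; ring | exact: IHn]. Qed.

Lemma gib_rec a b j : gib a b j = gib a b (j - 1) + gib a b (j - 2).
Proof.
case: j => [[|[|n]]|n].
- by rewrite /=; ring.
- by rewrite /=; ring.
- have -> : Posz n.+2 - 1 = Posz n.+1 by rewrite -addn1 PoszD addrK.
  have -> : Posz n.+2 - 2 = Posz n by rewrite -addn2 PoszD addrK.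
  exact: gib_upSS.
- have -> : Negz n - 1 = Negz n.+1 by rewrite !NegzE -opprD -PoszD addn1.
  have -> : Negz n - 2 = Negz n.+2 by rewrite !NegzE -opprD -PoszD addn2.
  exact: gib_downSS.
Qed.

(* Main.v *)
(** The Legendre-type identity
      sum_k C(n,k)^2 x^k = sum_k C(n,k) C(n+k,k) (x - 1)^(n-k)
    follows by expanding x^k = (1 + (x - 1))^k and applying Vandermonde's
    convolution.  For a root t of t^2 = t + 1, take
    x = (-1)^(s+1) (F_s / F_r) t^(r+s); then the relation
    F_(r+s) t^s - F_s t^(r+s) = (-1)^s F_r gives
    x - 1 = (-1)^(s+1) (F_(r+s) / F_r) t^s.  After multiplication by t^m this is
    the theorem for the sequence t^j, and every Gibonacci sequence is a linear
    combination of those given by the two roots (Binet). *)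
Require Import Defs.
From mathcomp Require Import all_boot all_order all_algebra all_field.
From mathcomp Require Import ring zify.
Import Order.TTheory GRing.Theory Num.Theory.
Local Open Scope ring_scope.

(** The last factor is 'C(n - j, k - j) in complementary form: this stays correct for [k < j], where
    both sides vanish, and it is the shape Vandermonde's convolution needs. *)
Lemma bin_mul_bin_sub (n k j : nat) : (k <= n)%N ->
  ('C(n, k) * 'C(k, j) = 'C(n, j) * 'C(n - j, n - k))%N.
Proof.
move=> le_kn; case: (leqP j k) => [le_jk | lt_kj]; last first.
  rewrite (bin_small lt_kj) muln0.
  case: (leqP j n) => [le_jn | lt_nj]; last by rewrite (bin_small lt_nj).
  by rewrite [X in (_ * X)%N]bin_small ?muln0 //; lia.
have le_jn := leq_trans le_jk le_kn.
have fact_pos : (0 < j`! * (k - j)`! * (n - k)`!)%N by rewrite !muln_gt0 !fact_gt0.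
apply/eqP; rewrite -(eqn_pmul2r fact_pos); apply/eqP.
have := bin_fact le_kn; have := bin_fact le_jk; have := bin_fact le_jn.
have := @bin_fact (n - j) (n - k) ltac:(lia).
have -> : (n - j - (n - k) = k - j)%N by lia.
move=> Enj Ejn Ejk Ekn.
transitivity n`!; [rewrite -Ekn -Ejk | rewrite -Ejn -Enj]; ring.
Qed.

Lemma sum_sqr_bin_bin (n j : nat) : (j <= n)%N ->
  (\sum_(k < n.+1) 'C(n, k) ^ 2 * 'C(k, j) = 'C(n, j) * 'C(n + (n - j), n))%N.
Proof.
move=> le_jn; rewrite -binomial.Vandermonde big_distrr /=.
apply: eq_bigr => k _.
by rewrite expnS expn1 -mulnA bin_mul_bin_sub -1?ltnS // mulnCA.
Qed.

Lemma sum_sqr_binX (R : comNzRingType) (x : R) (n : nat) :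
  \sum_(k < n.+1) 'C(n, k)%:R ^+ 2 * x ^+ k
  = \sum_(k < n.+1) 'C(n, k)%:R * 'C(n + k, k)%:R * (x - 1) ^+ (n - k).
Proof.
set y := x - 1.
(* The range of [j] is padded from [k] to [n] with zero terms, so that the two sums can be
   exchanged. *)
have expandX (k : 'I_n.+1) : x ^+ k = \sum_(j < n.+1) y ^+ j *+ 'C(k, j).
  have -> : x = 1 + y by rewrite /y addrC subrK.
  rewrite exprDn (big_ord_widen n.+1 (fun j => 1 ^+ (k - j) * y ^+ j *+ 'C(k, j))) //.
  rewrite big_mkcond; apply: eq_bigr => j _; rewrite expr1n mul1r ltnS.
  by case: leqP => // lt_kj; rewrite bin_small.
under eq_bigr => k _ do rewrite expandX big_distrr /=.
(* Reversing the right-hand sum lets both sides be compared coefficientwise at [y ^+ j]. *)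
rewrite exchange_big [RHS](reindex_inj rev_ord_inj) /=.
apply: eq_bigr => j _; have le_jn : (j <= n)%N by rewrite -ltnS.
rewrite subSS subKn // bin_sub //.
have -> : 'C(n + (n - j), n - j) = 'C(n + (n - j), n).
  by rewrite -[RHS]bin_sub ?leq_addr // addKn.
rewrite -natrM -sum_sqr_bin_bin // natr_sum big_distrl /=.
apply: eq_bigr => k _.
by rewrite natrM natrX -mulrA mulr_natl.
Qed.

Lemma gib_up_gt0 (a b : int) (n : nat) : 0 <= a -> 0 < b -> 0 < gib_up a b n.+1.
Proof.
elim: n a b => [|n IHn] a b a_ge0 b_gt0 //=.
by apply: IHn; [exact: ltW | exact: ltr_wpDl].
Qed.

(* Backward iteration alternates in sign, so the two sign patterns are handled
   together. *)
Lemma gib_down_neq0 (a b : int) (n : nat) :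
  (0 < a) && (b <= 0) || (a < 0) && (0 <= b) -> gib_down a b n != 0.
Proof.
elim: n a b => [|n IHn] a b ab_sign /=; first by lia.
by apply: IHn; lia.
Qed.

Lemma fibz_neq0 (r : int) : r != 0 -> fibz r != 0.
Proof.
case: r => [[|n] // _ | n _]; first by rewrite gt_eqF // (@gib_up_gt0 0 1 n).
exact: (gib_down_neq0 1 0 n).
Qed.

Lemma fib_rec_ext (V : zmodType) (u v : int -> V) :
  (forall j, u j = u (j - 1) + u (j - 2)) ->
  (forall j, v j = v (j - 1) + v (j - 2)) ->
  u 0 = v 0 -> u 1 = v 1 -> u =1 v.
Proof.
move=> u_rec v_rec uv0 uv1 j.
(* Carrying two consecutive values lets the recurrence step both up and down. *)
suff [] : u j = v j /\ u (j + 1) = v (j + 1) by [].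
elim/int_ind: j => [|n [IH0 IH1] | n [IH0 IH1]]; first by rewrite add0r.
- have -> : n.+1%:Z = n%:Z + 1 by lia.
  split=> //; rewrite u_rec v_rec.
  have -> : n%:Z + 1 + 1 - 1 = n%:Z + 1 by lia.
  have -> : n%:Z + 1 + 1 - 2 = n%:Z by lia.
  by rewrite IH0 IH1.
- have -> : - n.+1%:Z + 1 = - n%:Z by lia.
  split=> //; move: IH1; rewrite u_rec v_rec.
  have -> : - n%:Z + 1 - 1 = - n%:Z by lia.
  have -> : - n%:Z + 1 - 2 = - n.+1%:Z by lia.
  by rewrite IH0 => /addrI.
Qed.

Section Binet.

Variables (K : numFieldType) (t : K).
Hypothesis t_root : t ^+ 2 = t + 1.

Lemma golden_conj_root : (1 - t) ^+ 2 = (1 - t) + 1.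
Proof. by rewrite sqrrB t_root; ring. Qed.

Lemma golden_mul_conj : t * (1 - t) = -1.
Proof. by rewrite mulrBr mulr1 -expr2 t_root; ring. Qed.

Lemma golden_neq0 : t != 0.
Proof.
by apply/eqP => t0; move/eqP: t_root; rewrite t0 expr0n add0r eq_sym oner_eq0.
Qed.

(** This is the difference [t - (1 - t)] of the two roots, the denominator in Binet's formula. *)
Lemma golden_disc_neq0 : 2 * t - 1 != 0.
Proof.
rewrite -sqrf_eq0.
have -> : (2 * t - 1) ^+ 2 = 5.
  by transitivity (4 * t ^+ 2 - 4 * t + 1); [ring | rewrite t_root; ring].
by rewrite pnatr_eq0.
Qed.

Lemma exprz_golden (j : int) : t ^ j = t ^ (j - 1) + t ^ (j - 2).
Proof.
have -> : j - 1 = (j - 2) + 1 by lia.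
rewrite -[in LHS](subrK 2 j); move: (j - 2) => i.
rewrite (expfzDr i 2) ?(expfzDr i 1) ?golden_neq0 // -[t ^ 2]/(t ^+ 2) t_root expr1z.
by ring.
Qed.

End Binet.

Lemma gib_binet (K : numFieldType) (t : K) (a b j : int) : t ^+ 2 = t + 1 ->
  (2 * t - 1) * (gib a b j)%:~R
  = (b%:~R - a%:~R * (1 - t)) * t ^ j - (b%:~R - a%:~R * t) * (1 - t) ^ j.
Proof.
move=> t_root; have t'_root := golden_conj_root _ _ t_root.
move: j; apply: fib_rec_ext => [j | j | |].
- by rewrite [in LHS]gib_rec intrD mulrDr.
- rewrite [in LHS](exprz_golden _ _ t_root) [in LHS](exprz_golden _ _ t'_root).
  by ring.
- by rewrite !expr0z /=; ring.
- by rewrite !expr1z /=; ring.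
Qed.

(** With u = 1 - t, Binet's formula cancels the t^(r+2s) terms and leaves (t u)^s (t^r - u^r), where
    t u = -1. *)
Lemma golden_fib_sub (K : numFieldType) (t : K) (r s : int) : t ^+ 2 = t + 1 ->
  (fibz (r + s))%:~R * t ^ s - (fibz s)%:~R * t ^ (r + s)
  = (-1) ^ s * (fibz r)%:~R.
Proof.
move=> t_root; have t'_root := golden_conj_root _ _ t_root.
apply: (mulfI (golden_disc_neq0 _ _ t_root)).
rewrite mulrBr mulrA [in X in _ - X]mulrA [RHS]mulrCA !(gib_binet _ _ _ _ _ t_root).
rewrite -(golden_mul_conj _ _ t_root) expfzMl !expfzDr ?golden_neq0 //.
by ring.
Qed.

Lemma golden_sum (K : numFieldType) (t : K) (r s m : int) (n : nat) :
  t ^+ 2 = t + 1 -> r != 0 ->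
  \sum_(k < n.+1)
     (-1) ^ (k%:Z * (s + 1)) * 'C(n, k)%:R ^+ 2
     * ((fibz s)%:~R / (fibz r)%:~R) ^+ k * t ^ ((r + s) * k%:Z + m)
  = \sum_(k < n.+1)
     (-1) ^ ((s + 1) * (n - k)%N%:Z) * 'C(n, k)%:R * 'C(n + k, k)%:R
     * ((fibz (r + s))%:~R / (fibz r)%:~R) ^+ (n - k)
     * t ^ (s * (n - k)%N%:Z + m).
Proof.
move=> t_root r_neq0; have t_neq0 := golden_neq0 _ _ t_root.
have Fr_neq0 : (fibz r)%:~R != 0 :> K by rewrite intr_eq0 fibz_neq0.
set e : K := (-1) ^ (s + 1).
pose x := e * ((fibz s)%:~R / (fibz r)%:~R) * t ^ (r + s).
have x_sub1 : x - 1 = e * ((fibz (r + s))%:~R / (fibz r)%:~R) * t ^ s.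
  (* The exponent 2s + 1 is odd. *)
  have e_s : e * (-1) ^ s = -1.
    rewrite /e expfzDr ?oppr_eq0 ?oner_eq0 // expr1z mulrAC.
    by rewrite -expfzMl mulrNN mulr1 exp1rz mul1r.
  apply: (mulIf Fr_neq0); apply/eqP; rewrite -subr_eq0; apply/eqP.
  transitivity (- (e * ((fibz (r + s))%:~R * t ^ s - (fibz s)%:~R * t ^ (r + s)))
                - (fibz r)%:~R); first by rewrite /x; field.
  by rewrite golden_fib_sub // mulrA e_s; ring.
transitivity (t ^ m * \sum_(k < n.+1) 'C(n, k)%:R ^+ 2 * x ^+ k).
  rewrite big_distrr /=; apply: eq_bigr => k _.
  rewrite /x !exprMn (mulrC k%:Z) expfzDr // -!exprz_exp -/e -!exprnP.
  by ring.
rewrite sum_sqr_binX x_sub1 big_distrr /=; apply: eq_bigr => k _.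
rewrite !exprMn expfzDr // -!exprz_exp -/e -!exprnP.
by ring.
Qed.

Lemma gib_sum (a b r s m : int) (n : nat) : r != 0 ->
  \sum_(k < n.+1)
     (-1 : rat) ^ (k%:Z * (s + 1)) * 'C(n, k)%:R ^+ 2
     * ((fibz s)%:~R / (fibz r)%:~R) ^+ k * (gib a b ((r + s) * k%:Z + m))%:~R
  = \sum_(k < n.+1)
     (-1 : rat) ^ ((s + 1) * (n - k)%N%:Z) * 'C(n, k)%:R * 'C(n + k, k)%:R
     * ((fibz (r + s))%:~R / (fibz r)%:~R) ^+ (n - k)
     * (gib a b (s * (n - k)%N%:Z + m))%:~R.
Proof.
move=> r_neq0.
pose t : algC := (1 + sqrtC 5) / 2.
have t_root : t ^+ 2 = t + 1.
  by rewrite /t expr_div_n sqrrD sqrtCK; field.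
have t'_root := golden_conj_root _ _ t_root.
(* The roots are irrational, so the rational identity is transported along the injective map
   [ratr]. *)
apply: (fmorph_inj (ratr : {rmorphism rat -> algC})).
apply: (mulfI (golden_disc_neq0 _ _ t_root)).
(* The Binet coefficients depend on neither [w] nor [f], so both sides of the goal become the same
   combination of sums over powers of [t] and of [1 - t], and [golden_sum] applies to each root. *)
have binet_sum (w : 'I_n.+1 -> algC) (f : 'I_n.+1 -> int) :
  (2 * t - 1) * (\sum_k w k * (gib a b (f k))%:~R)
  = (b%:~R - a%:~R * (1 - t)) * (\sum_k w k * t ^ f k)
    - (b%:~R - a%:~R * t) * (\sum_k w k * (1 - t) ^ f k).
  rewrite !big_distrr -sumrB /=; apply: eq_bigr => k _.
  by rewrite mulrCA gib_binet //; ring.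
rewrite !rmorph_sum /=.
under eq_bigr => k _.
  rewrite !rmorphM fmorphXz rmorphN1 !rmorphXn rmorph_nat fmorph_div /=.
  rewrite !ratr_int; over.
under [in RHS]eq_bigr => k _.
  rewrite !rmorphM fmorphXz rmorphN1 !rmorphXn !rmorph_nat fmorph_div /=.
  rewrite !ratr_int; over.
by rewrite !binet_sum !golden_sum.
Qed.

Theorem theorem32 (r s m : int) (hr : r != 0) (n : nat) :
  (\sum_(k < n.+1)
      (-1 : rat) ^ (k%:Z * (s + 1)) * ('C(n, k)%:R) ^+ 2
      * ((fibz s)%:~R / (fibz r)%:~R) ^+ k
      * (fibz ((r + s) * k%:Z + m))%:~R
   = \sum_(k < n.+1)
      (-1 : rat) ^ ((s + 1) * (n - k)%N%:Z) * 'C(n, k)%:R * 'C(n + k, k)%:R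
      * ((fibz (r + s))%:~R / (fibz r)%:~R) ^+ (n - k)
      * (fibz (s * (n - k)%N%:Z + m))%:~R)
  /\
  (\sum_(k < n.+1)
      (-1 : rat) ^ (k%:Z * (s + 1)) * ('C(n, k)%:R) ^+ 2
      * ((fibz s)%:~R / (fibz r)%:~R) ^+ k
      * (lucz ((r + s) * k%:Z + m))%:~R
   = \sum_(k < n.+1)
      (-1 : rat) ^ ((s + 1) * (n - k)%N%:Z) * 'C(n, k)%:R * 'C(n + k, k)%:R
      * ((fibz (r + s))%:~R / (fibz r)%:~R) ^+ (n - k)
      * (lucz (s * (n - k)%N%:Z + m))%:~R).
Proof. by split; apply: gib_sum. Qed.
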